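(* For all $n\ge3$, we have $c_n(123,132,231,312)=2$.
   Context: A word $\pi=\pi_1\dots\pi_m$ over the positive integers contains the pattern $\sigma=\sigma_1\dots\sigma_k$ if there are indices $1\le i_1<\dots<i_k\le m$ such that for all $r,s\in\{1,\dots,k\}$: $\pi_{i_r}<\pi_{i_s}$ iff $\sigma_r<\sigma_s$, and $\pi_{i_r}=\pi_{i_s}$ iff $\sigma_r=\sigma_s$; otherwise $\pi$ avoids $\sigma$. $\mathcal{C}_n$ denotes the set of nonnesting permutations: arrangements (words) of the multiset $\{1,1,2,2,\dots,n,n\}$ that avoid the patterns $1221$ and $2112$. For patterns $\sigma,\tau,\dots$, $c_n(\sigma,\tau,\dots)$ is the number of $\pi\in\mathcal{C}_n$ avoiding all of $\sigma,\tau,\dots$. *)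

(* Defs.v *)
From mathcomp Require Import all_boot.

Set Implicit Arguments.
Unset Strict Implicit.
Unset Printing Implicit Defensive.

(* Indices are 0-based; since they are ordinals below the sizes of the words,
   the default value 0 of [nth] is never reached. *)
Definition contains (w p : seq nat) : bool :=
  [exists i : {ffun 'I_(size p) -> 'I_(size w)},
    [forall r : 'I_(size p), forall s : 'I_(size p), (r < s) ==> (i r < i s)] &&
    [forall r : 'I_(size p), forall s : 'I_(size p),
      ((nth 0 w (i r) < nth 0 w (i s)) == (nth 0 p r < nth 0 p s)) &&
      ((nth 0 w (i r) == nth 0 w (i s)) == (nth 0 p r == nth 0 p s))]].

Definition avoids (w p : seq nat) : bool := ~~ contains w p.

(* The multiset {1,1,2,2,...,n,n}, as a sequence. *)
Definition doubled (n : nat) : seq nat := flatten [seq [:: k; k] | k <- iota 1 n].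

Definition nonnesting (w : seq nat) : bool :=
  avoids w [:: 1; 2; 2; 1] && avoids w [:: 2; 1; 1; 2].

(* [permutations s] lists the distinct rearrangements of [s] without repetition
   ([permutations_uniq], [mem_permutations]), so repeated letters of [s] do not
   cause overcounting. *)
Definition nonnesting_perms (n : nat) : seq (seq nat) :=
  [seq w <- permutations (doubled n) | nonnesting w].

Definition c (n : nat) (ps : seq (seq nat)) : nat :=
  size [seq w <- nonnesting_perms n | all (avoids w) ps].

(* Main.v *)
Require Import Defs.
From mathcomp Require Import all_boot zify.

(** Write [n] for the largest letter.  The two words counted are
    [n n (n-1) (n-1) .. 1 1] and [(n-1) (n-1) .. 1 1 n n].

    The letter [n] controls everything.  If [x < y < n] and [x] occurs before
    [y], then a copy of [n] before, between or after them makes a 312, a 132 or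
    a 123; so the letters below [n] are in weakly decreasing order
    ([small_letters_descend]).  If [x] occurs before a copy of [n] and [y] after
    it, with [x], [y] below [n], then [x <> y] would make a 132 or a 231
    ([letters_around_max_eq]).  As at least two distinct letters lie below [n]
    when [n >= 3], all the smaller letters lie on one side of each copy of [n]
    ([no_letters_beside_max]).  This leaves three words: both copies of [n] at
    the front, both at the back, or one at each end; the last one contains
    [n 1 1 n], an occurrence of 2112, and is not nonnesting
    ([avoider_classification]).

    Conversely the decreasing word contains no ascent, while every pattern
    concerned has one.  In the other word, two letters [x], [y] in this order
    satisfy [y = n] or [y <= x < n]; this relation passes to subsequences, and
    every occurrence of one of the patterns has a pair of letters violating it
    ([avoids_valley_word]). *)

(** * Containment through subsequences *)

Definition order_iso (t p : seq nat) : bool :=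
  (size t == size p) &&
  all (fun r => all (fun s =>
      ((nth 0 t r < nth 0 t s) == (nth 0 p r < nth 0 p s)) &&
      ((nth 0 t r == nth 0 t s) == (nth 0 p r == nth 0 p s)))
    (iota 0 (size p))) (iota 0 (size p)).

Lemma order_isoP t p :
  reflect (size t = size p /\ forall r s, r < size p -> s < size p ->
     ((nth 0 t r < nth 0 t s) == (nth 0 p r < nth 0 p s)) &&
     ((nth 0 t r == nth 0 t s) == (nth 0 p r == nth 0 p s)))
   (order_iso t p).
Proof.
apply: (iffP andP) => -[/eqP-> H]; split=> //.
  by move=> r s hr hs; apply: (allP (allP H r _)); rewrite mem_iota.
by apply/allP=> r; rewrite mem_iota => hr; apply/allP=> s; rewrite mem_iota => hs;
  apply: H.
Qed.

Lemma ltn_sorted_subseq_iota (s : seq nat) n :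
  sorted ltn s -> all (gtn n) s -> subseq s (iota 0 n).
Proof.
move=> s_sorted /allP s_lt.
suff -> : s = [seq i <- iota 0 n | i \in s] by apply: filter_subseq.
apply: (irr_sorted_eq ltn_trans ltnn) => //.
  by apply: (sorted_filter ltn_trans); apply: iota_ltn_sorted.
move=> i; rewrite mem_filter mem_iota /= add0n.
by case: (boolP (i \in s)) => // /s_lt /= ->.
Qed.

(** Embeddings of index sets are awkward to handle; all later arguments see
    containment only through [subseq], and [order_iso] computes on concrete
    patterns. *)
Lemma containsP w p :
  reflect (exists2 t, subseq t w & order_iso t p) (contains w p).
Proof.
apply: (iffP existsP) => [[i /andP[i_incr i_iso]] | [t]].
  set idx := [seq nat_of_ord (i r) | r <- enum 'I_(size p)].
  have nth_idx (r : 'I_(size p)) : nth 0 idx r = i r.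
    by rewrite (nth_map r) ?nth_ord_enum // size_enum_ord.
  have size_idx : size idx = size p by rewrite size_map size_enum_ord.
  exists [seq nth 0 w j | j <- idx].
    rewrite -[X in subseq _ X](mkseq_nth 0) /mkseq map_subseq //.
    apply: ltn_sorted_subseq_iota; last by apply/allP=> _ /mapP[r _ ->] /=.
    apply/(sortedP 0) => k; rewrite size_idx => lt_k.
    have /= := nth_idx (Ordinal (ltnW lt_k)); have /= := nth_idx (Ordinal lt_k).
    move=> -> ->; exact: implyP (forallP (forallP i_incr _) _) _.
  apply/order_isoP; split=> [|r s hr hs]; first by rewrite size_map.
  rewrite !(nth_map 0) ?size_idx //.
  rewrite (nth_idx (Ordinal hr)) (nth_idx (Ordinal hs)).
  exact: (forallP (forallP i_iso (Ordinal hr)) (Ordinal hs)).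
case/subseqP=> m size_m -> /order_isoP[size_t t_iso].
set idx := mask m (iota 0 (size w)).
have idx_w : mask m w = [seq nth 0 w j | j <- idx].
  by rewrite map_mask map_nth_iota0 ?take_size.
have size_idx : size idx = size p by rewrite -size_t idx_w size_map.
have idx_lt k : k < size p -> nth 0 idx k < size w.
  rewrite -size_idx => /(mem_nth 0) /mem_mask.
  by rewrite mem_iota.
exists [ffun r : 'I_(size p) => Ordinal (idx_lt r (ltn_ord r))].
apply/andP; split; apply/forallP=> r; apply/forallP=> s; rewrite !ffunE /=.
  apply/implyP=> lt_rs.
  apply: (sorted_ltn_nth ltn_trans) => //; rewrite ?inE ?size_idx //.
  by apply: (sorted_mask ltn_trans); apply: iota_ltn_sorted.
by have := t_iso r s (ltn_ord r) (ltn_ord s); rewrite idx_w !(nth_map 0) ?size_idx.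
Qed.

Lemma avoids_subseq w p t :
  avoids w p -> subseq t w -> ~~ order_iso t p.
Proof.
by move=> av sub; apply: contra av => iso; apply/containsP; exists t.
Qed.

Lemma avoidsI w p :
  (forall t, subseq t w -> order_iso t p -> False) -> avoids w p.
Proof. by move=> H; apply/negP=> /containsP[t /H]. Qed.

(** * Splitting words *)

(** Any occurrence of [x] in [w] falls in some gap of [s], since [s] itself
    does not use the letter [x]. *)
Lemma subseq_insert (T : eqType) (x : T) s w :
    subseq s w -> x \in w -> x \notin s ->
  exists s1 s2, s = s1 ++ s2 /\ subseq (s1 ++ x :: s2) w.
Proof.
elim: w s => // y w IHw s /[swap]; rewrite inE => /predU1P[<- | w_x] sub_s s'x.
  exists [::], s; split=> //=; rewrite eqxx.
  case: s sub_s s'x => [|z s] /=; first by rewrite sub0seq.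
  by rewrite inE [x == z]eq_sym => + /norP[/negPf neq_zx _]; rewrite neq_zx.
case: s sub_s s'x => [|z s].
  by move=> _ _; exists [::], [::]; split=> //; rewrite cat0s sub1seq inE w_x orbT.
rewrite /= inE negb_or => + /andP[neq_xz s'x].
case: (z =P y) => [-> | _] sub_s.
  have [s1 [s2 [-> sub]]] := IHw s sub_s w_x s'x.
  by exists (y :: s1), s2; rewrite /= eqxx.
have [|s1 [s2 [-> sub]]] := IHw (z :: s) sub_s w_x; first by rewrite inE negb_or neq_xz.
by exists s1, s2; split=> //; exact: subseq_trans sub (subseq_cons w y).
Qed.

Lemma geq_trans : transitive geq.
Proof. by move=> y x z /= le_yx le_zy; apply: leq_trans le_zy le_yx. Qed.

Lemma sorted_geqP (s : seq nat) :
  reflect (forall x y, subseq [:: x; y] s -> y <= x) (sorted geq s).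
Proof.
apply: (iffP idP) => [s_sorted x y /subseq_sorted | no_asc].
  by move=> /(_ _ geq_trans s_sorted) /=; rewrite andbT.
apply: pairwise_sorted; elim: s no_asc => //= x s IHs no_asc.
apply/andP; split.
  by apply/allP=> y s_y; apply: no_asc; rewrite eqxx sub1seq.
by apply: IHs => y z sub; apply: no_asc; apply: subseq_trans sub (subseq_cons _ _).
Qed.

Lemma split_first (T : eqType) (x : T) s :
  x \in s -> exists s1 s2, s = s1 ++ x :: s2 /\ x \notin s1.
Proof.
move=> s_x; exists (take (index x s) s), (drop (index x s).+1 s).
rewrite in_take // ltnn; split=> //.
by rewrite -[X in X = _](cat_take_drop (index x s)) (drop_nth x) ?index_mem // nth_index.
Qed.

Lemma split_count2 (T : eqType) (x : T) s :
  count_mem x s = 2 ->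
  exists s1 s2 s3, s = s1 ++ x :: s2 ++ x :: s3 /\ x \notin s1 ++ s2 ++ s3.
Proof.
move=> count_x; have s_x : x \in s by rewrite -has_pred1 has_count count_x.
have [s1 [u [def_s s1'x]]] := split_first _ _ _ s_x.
move: count_x; rewrite def_s count_cat (count_memPn s1'x) /= eqxx add1n => -[count_u].
have u_x : x \in u by rewrite -has_pred1 has_count count_u.
have [s2 [s3 [def_u s2'x]]] := split_first _ _ _ u_x.
move: count_u; rewrite def_u count_cat (count_memPn s2'x) /= eqxx add1n => -[/count_memPn s3'x].
exists s1, s2, s3; split=> //.
by rewrite !mem_cat !negb_or s1'x s2'x.
Qed.

(** * The decreasing word *)

Lemma doubledS n : doubled n.+1 = doubled n ++ [:: n.+1; n.+1].
Proof. by rewrite /doubled -[X in iota 1 X]addn1 iotaD map_cat flatten_cat. Qed.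

Lemma mem_doubled n k : (k \in doubled n) = (0 < k <= n).
Proof.
elim: n => [|n IHn]; first by case: k.
by rewrite doubledS mem_cat IHn !inE; lia.
Qed.

Lemma rev_doubledS n : rev (doubled n.+1) = [:: n.+1; n.+1] ++ rev (doubled n).
Proof. by rewrite doubledS rev_cat. Qed.

Lemma sorted_rev_doubled n : sorted geq (rev (doubled n)).
Proof.
elim: n => // n IHn; rewrite rev_doubledS /= leqnn /=.
rewrite path_min_sorted //; apply/allP=> x.
by rewrite mem_rev mem_doubled /=; lia.
Qed.

Lemma subseq_ones m : 0 < m -> subseq [:: 1; 1] (rev (doubled m)).
Proof.
case: m => // k _.
rewrite -[doubled _]/([:: 1; 1] ++ flatten [seq [:: j; j] | j <- iota 2 k]).
by rewrite rev_cat suffix_subseq.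
Qed.

(** * Letters around the largest letter *)

(** A copy of [n] inserted into an ascent [x < y] yields 312, 132 or 123
    according to the gap it falls in. *)
Lemma small_letters_descend n w (x y : nat) :
  n \in w -> x < n -> y < n ->
  avoids w [:: 1; 2; 3] -> avoids w [:: 1; 3; 2] -> avoids w [:: 3; 1; 2] ->
  subseq [:: x; y] w -> y <= x.
Proof.
move=> w_n lt_xn lt_yn av123 av132 av312 sub.
rewrite leqNgt; apply/negP=> lt_xy.
have [|s1 [s2 [def_s sub_n]]] := subseq_insert _ n _ _ sub w_n.
  by rewrite !inE; lia.
case: s1 def_s sub_n => [|a [|b [|? ?]]] //; rewrite ?cat_cons cat0s.
- by move=> <- /(avoids_subseq _ _ _ av312); rewrite /order_iso /=; lia.
- by move=> -[<- <-] /(avoids_subseq _ _ _ av132); rewrite /order_iso /=; lia.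
- by move=> -[<- <- <-] /(avoids_subseq _ _ _ av123); rewrite /order_iso /=; lia.
Qed.

(** Otherwise [x n y] is an occurrence of 132 or of 231. *)
Lemma letters_around_max_eq n u v (x y : nat) :
  avoids (u ++ n :: v) [:: 1; 3; 2] -> avoids (u ++ n :: v) [:: 2; 3; 1] ->
  x \in u -> y \in v -> x < n -> y < n -> x = y.
Proof.
move=> av132 av231 u_x v_y lt_xn lt_yn.
have sub : subseq [:: x; n; y] (u ++ n :: v).
  by rewrite -[[:: x; n; y]]/([:: x] ++ [:: n; y]) cat_subseq //= ?eqxx sub1seq.
have := avoids_subseq _ _ _ av132 sub; have := avoids_subseq _ _ _ av231 sub.
by rewrite /order_iso /=; lia.
Qed.

(** If small letters stood on both sides, each on the left would equal each on
    the right, so there would be just one small letter.  The filters are there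
    because [u] or [v] may contain the other copy of [n]. *)
Lemma no_letters_beside_max n (u v : seq nat) :
  avoids (u ++ n :: v) [:: 1; 3; 2] -> avoids (u ++ n :: v) [:: 2; 3; 1] ->
  (exists x y, [/\ x < n, y < n, x != y, x \in u ++ v & y \in u ++ v]) ->
  [seq i <- u | i < n] = [::] \/ [seq i <- v | i < n] = [::].
Proof.
move=> av132 av231 [x [y [lt_xn lt_yn neq_xy]]]; rewrite !mem_cat.
have flank := letters_around_max_eq n u v _ _ av132 av231.
case Du: [seq i <- u | i < n] => [|a u'] ; first by left.
case Dv: [seq i <- v | i < n] => [|b v'] ; first by right.
have /andP[lt_an u_a] : (a < n) && (a \in u).
  by rewrite -(mem_filter (fun i => i < n)) Du mem_head.
have /andP[lt_bn v_b] : (b < n) && (b \in v).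
  by rewrite -(mem_filter (fun i => i < n)) Dv mem_head.
have ab := flank a b u_a v_b lt_an lt_bn.
have all_a z : z < n -> z \in u \/ z \in v -> z = a.
  move=> lt_zn [u_z | v_z]; first by rewrite ab; apply: flank.
  by apply/esym; apply: flank.
by move=> /orP/all_a Dx /orP/all_a Dy; rewrite Dx // Dy // eqxx in neq_xy.
Qed.

(** * The two words avoid the patterns *)

Lemma avoids_sorted_geq w p : sorted geq w -> ~~ sorted geq p -> avoids w p.
Proof.
move=> /sorted_geqP w_desc p_asc; apply: avoidsI => t sub_t /order_isoP[size_t iso].
have /(sortedP 0) t_desc : sorted geq t.
  by apply/sorted_geqP => x y sub; apply: w_desc; apply: subseq_trans sub sub_t.
case/negP: p_asc; apply/(sortedP 0) => r lt_r /=.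
rewrite leqNgt -(eqP (andP (iso r r.+1 (ltnW lt_r) lt_r)).1) -leqNgt.
by apply: t_desc; rewrite size_t.
Qed.

(** Indexed by the second largest letter, to avoid predecessors. *)
Definition valley_word m := rev (doubled m) ++ [:: m.+1; m.+1].

(** A single relation on pairs captures the shape of the word well enough to
    exclude every pattern: an ascent ends at the largest letter, and nothing
    smaller follows that letter. *)
Lemma pairwise_valley_word m :
  pairwise (fun x y => (y == m.+1) || (y <= x <= m)) (valley_word m).
Proof.
rewrite pairwise_cat /= eqxx /= !andbT; apply/andP; split.
  by apply/allrelP=> x y _; rewrite !inE orbb => ->.
have le_m x : x \in rev (doubled m) -> x <= m by rewrite mem_rev mem_doubled => /andP[].
elim: (rev _) le_m (sorted_rev_doubled m) => //= x s IHs le_m s_desc.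
rewrite IHs ?andbT; last exact: path_sorted s_desc.
  2: by move=> y s_y; apply: le_m; rewrite inE s_y orbT.
apply/allP=> y /(allP (order_path_min geq_trans s_desc)) /= ->.
by rewrite le_m ?orbT ?mem_head.
Qed.

Lemma avoids_valley_word m :
  all (avoids (valley_word m))
    [:: [:: 1; 2; 2; 1]; [:: 2; 1; 1; 2];
        [:: 1; 2; 3]; [:: 1; 3; 2]; [:: 2; 3; 1]; [:: 3; 1; 2]].
Proof.
have pw t : subseq t (valley_word m) ->
    pairwise (fun x y => (y == m.+1) || (y <= x <= m)) t.
  by move=> sub; apply: subseq_pairwise sub (pairwise_valley_word m).
apply/allP=> p; rewrite !inE => /or4P[||| /or3P[]] /eqP->; apply: avoidsI.
all: move=> [|a [|b [|d [|e [|? ?]]]]] // /pw; rewrite /order_iso /=; lia.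
Qed.

Lemma perm_valley_word m : perm_eq (valley_word m) (doubled m.+1).
Proof. by rewrite doubledS /valley_word perm_cat2r perm_rev. Qed.

(** * No other word avoids them *)

(** The bound [1 < m] provides the two distinct letters 1 and 2 below
    [m.+1]. *)
Lemma avoider_classification m w :
  1 < m -> perm_eq w (doubled m.+1) -> avoids w [:: 2; 1; 1; 2] ->
  all (avoids w) [:: [:: 1; 2; 3]; [:: 1; 3; 2]; [:: 2; 3; 1]; [:: 3; 1; 2]] ->
  w = rev (doubled m.+1) \/ w = valley_word m.
Proof.
move=> m_gt1 w_perm av2112 /and5P[av123 av132 av231 av312 _].
have w_mem : w =i doubled m.+1 := perm_mem w_perm.
have w_n : m.+1 \in w by rewrite w_mem mem_doubled /=.
have count_n : count_mem m.+1 w = 2.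
  rewrite (permP w_perm) doubledS count_cat /= eqxx.
  by rewrite (count_memPn _) // mem_doubled ltnn andbF.
have w_small : [seq i <- w | i < m.+1] = rev (doubled m).
  apply: (sorted_eq geq_trans); last 1 first.
  - rewrite perm_sym perm_rev perm_sym; apply: perm_trans (perm_filter _ w_perm) _.
    rewrite doubledS filter_cat /= ltnn cats0 (all_filterP _) //.
    by apply/allP=> x; rewrite mem_doubled => /andP[].
  - by move=> x y /=; rewrite andbC; apply: anti_leq.
  - apply/sorted_geqP => x y sub.
    have small z : z \in [:: x; y] -> z < m.+1.
      by move/(mem_subseq sub); rewrite mem_filter => /andP[].
    apply: small_letters_descend w_n _ _ av123 av132 av312 _; rewrite ?small ?inE ?eqxx ?orbT //.
    exact: subseq_trans sub (filter_subseq _ _).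
  - exact: sorted_rev_doubled.
have [w1 [w2 [w3 [def_w w'n]]]] := split_count2 _ _ _ count_n.
have small_part s : {subset s <= w1 ++ w2 ++ w3} -> [seq i <- s | i < m.+1] = s.
  move=> sub; apply/all_filterP/allP => x /sub x_parts.
  have : x \in doubled m.+1.
    rewrite -w_mem def_w; move: x_parts; rewrite !(mem_cat, inE).
    by case/or3P=> ->; rewrite ?orbT.
  rewrite mem_doubled => /andP[_ le_x].
  by rewrite ltn_neqAle le_x andbT; apply: contraNneq w'n => <-.
have small1 : [seq i <- w1 | i < m.+1] = w1.
  by apply: small_part => x; rewrite !mem_cat => ->.
have small2 : [seq i <- w2 | i < m.+1] = w2.
  by apply: small_part => x; rewrite !mem_cat => ->; rewrite orbT.
have small3 : [seq i <- w3 | i < m.+1] = w3.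
  by apply: small_part => x; rewrite !mem_cat => ->; rewrite !orbT.
have parts : w1 ++ w2 ++ w3 = rev (doubled m).
  rewrite -w_small def_w filter_cat /= ltnn filter_cat /= ltnn.
  by rewrite small1 small2 small3.
(* Applied below to each of the two copies of [m.+1]. *)
have nil_side u v : w = u ++ m.+1 :: v ->
    [seq i <- u | i < m.+1] = [::] \/ [seq i <- v | i < m.+1] = [::].
  move=> def_uv; apply: no_letters_beside_max; rewrite -?def_uv //.
  have uv_x x : x \in doubled m -> (x < m.+1) && (x \in u ++ v).
    rewrite -mem_rev -w_small def_uv mem_filter !mem_cat inE.
    by case/andP=> lt_x; rewrite lt_x (ltn_eqF lt_x).
  have /andP[lt1 uv1] : (1 < m.+1) && (1 \in u ++ v).
    by apply: uv_x; rewrite mem_doubled; lia.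
  have /andP[lt2 uv2] : (2 < m.+1) && (2 \in u ++ v).
    by apply: uv_x; rewrite mem_doubled; lia.
  by exists 1, 2.
have side1 : w1 = [::] \/ w2 ++ w3 = [::].
  by have := nil_side _ _ def_w; rewrite filter_cat /= ltnn small1 small2 small3.
have side2 : w1 ++ w2 = [::] \/ w3 = [::].
  have := nil_side (w1 ++ m.+1 :: w2) w3; rewrite -catA cat_cons => /(_ def_w).
  by rewrite filter_cat /= ltnn small1 small2 small3.
rewrite rev_doubledS /valley_word -parts {}def_w in av2112 *.
case: side1 => [w1_0 | w23_0]; last first.
  right; move: w23_0; case: w2 {nil_side small_part small2 side2 w'n av2112 parts}.
    by move=> /= ->; rewrite cats0.
  by [].
case: side2 => [w12_0 | w3_0].
  by left; move: w12_0; rewrite w1_0 /= => ->.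
(* One copy of the largest letter at each end: [m.+1 1 1 m.+1] is a 2112. *)
suff sub : subseq [:: m.+1; 1; 1; m.+1] (w1 ++ m.+1 :: w2 ++ m.+1 :: w3).
  by have := avoids_subseq _ _ _ av2112 sub; rewrite /order_iso /=; lia.
rewrite w1_0 w3_0 -[[:: m.+1; 1; 1; _]]/([:: m.+1] ++ [:: 1; 1] ++ [:: m.+1]).
rewrite -[[::] ++ _]/([:: m.+1] ++ w2 ++ [:: m.+1]) subseq_cat2l subseq_cat2r.
by move: parts; rewrite w1_0 w3_0 cats0 /= => ->; apply: subseq_ones; apply: ltnW.
Qed.

Theorem theorem2p17 (n : nat) (hn : 3 <= n) :
  c n [:: [:: 1; 2; 3]; [:: 1; 3; 2]; [:: 2; 3; 1]; [:: 3; 1; 2]] = 2.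
Proof.
case: n hn => // m m_gt1; rewrite /c.
set l := filter _ _; rewrite -[RHS]/(size [:: rev (doubled m.+1); valley_word m]).
apply/perm_size/uniq_perm.
- by rewrite !filter_uniq ?permutations_uniq.
(* The two words differ in their first letter. *)
- rewrite /= inE andbT; apply/eqP => /(congr1 (head 0)).
  rewrite rev_doubledS /valley_word; case: m m_gt1 {l} => // m _.
  by rewrite rev_doubledS /=; lia.
move=> w; rewrite !mem_filter mem_permutations !inE.
apply/idP/idP.
  case/and3P=> avs /andP[_ av2112] w_perm.
  by case: (avoider_classification _ _ m_gt1 w_perm av2112 avs) => ->; rewrite eqxx ?orbT.
case/orP=> /eqP->.
  by rewrite perm_rev perm_refl /nonnesting /= !avoids_sorted_geq // sorted_rev_doubled.
rewrite perm_valley_word andbT /nonnesting.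
by have /= := avoids_valley_word m; case/and3P=> -> -> ->.
Qed.
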